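(* Let $0<z<w<1$, $\mathcal{Z}=\{z,w\}$, $\Lambda=\{z,w\}^{\mathbb{Z}}$, and let $\nu$ be the Bernoulli probability measure on $\Lambda$ with $\nu([\lambda_0=z])=p$, $\nu([\lambda_0=w])=q$, where $p,q>0$ and $p+q=1$. Let $E=\{0,1\}$, let $A:E\times E\to\{0,1\}$ be an irreducible incidence matrix, and let $\phi_e(t)=\alpha_e t+\beta_e$ ($t\in[0,1]$, $e\in E$) with $\alpha_e,\beta_e\in(0,1)$, $\phi_e([0,1])\subseteq[0,1]$ and $\phi_0((0,1))\cap\phi_1((0,1))=\emptyset$. Assume $\alpha_0=\alpha_1=\alpha$ and that the system $\{\phi_e\}_{e\in E}$ (with incidence matrix $A$) is strongly regular. Consider the random system $\phi_e^{\lambda}(t)=\lambda_0\phi_e(t)$, $e\in E$, $\lambda\in\Lambda$, with its counting function $N_\rho^\lambda(T)$ and the number $\delta_\Lambda$. Then for every $\rho\in E_A^{\mathbb{N}}$ and for $\nu$-almost every $\lambda\in\Lambda$, $$\liminf_{T\to\infty}\frac{N_\rho^\lambda(T)}{\exp(\delta_\Lambda T)}=0\qquad\text{and}\qquad \limsup_{T\to\infty}\frac{N_\rho^\lambda(T)}{\exp(\delta_\Lambda T)}=\infty .$$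
   Context: Symbolic space. $E_A^{\mathbb{N}}$ is the set of infinite sequences $\rho=\rho_1\rho_2\rho_3\ldots$ in $E$ with $A(\rho_i,\rho_{i+1})=1$ for all $i\ge 1$ (admissible sequences); $E_A^n$ is the set of admissible words $\omega=\omega_1\ldots\omega_n$ of length $|\omega|=n$, i.e. $A(\omega_i,\omega_{i+1})=1$ for $1\le i<n$; $E_A^*=\bigcup_{n\ge1}E_A^n$. For $\rho\in E_A^{\mathbb{N}}$, $E_\rho^*$ is the set of all $\omega\in E_A^*$ such that the concatenation $\omega\rho$ is admissible. $A$ is irreducible if for all $e,e'\in E$ there is a word $\omega$ such that $e\omega e'$ is admissible. $\sigma$ is the left shift on $E_A^{\mathbb{N}}$. Random parameters. Elements of $\Lambda$ are two-sided sequences $\lambda=(\lambda_i)_{i\in\mathbb{Z}}$, and $[\lambda_0=z]=\{\lambda\in\Lambda:\lambda_0=z\}$. The product measure $\nu$ is invariant under the left shift of $\Lambda$. Potentials. The deterministic potential is $f(\rho)=\log|\phi_{\rho_1}'|=\log\alpha_{\rho_1}$, with $S_nf(\rho)=\sum_{i=0}^{n-1}f(\sigma^i\rho)$. The random potential is $f(\rho,\lambda)=\log(\alpha_{\rho_1}\lambda_0)$, with random ergodic sum $$S_nf(\rho,\lambda)=S_nf(\rho)+\log|\lambda_0\lambda_1\cdots\lambda_{n-1}|.$$ Pressure. $P(x)=\lim_{n\to\infty}\frac1n\log\sum_{\omega\in E_A^n}\exp\bigl(x\sup_{[\omega]}S_nf\bigr)$ for $x\in\mathbb{R}$, where $[\omega]$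 is the set of $\rho\in E_A^{\mathbb{N}}$ beginning with $\omega$. The system $\{\phi_e\}$ (or $f$) is strongly regular if $P(x)=0$ for some $x>0$ and $0<P(x)<\infty$ for some $x>0$. The expected pressure of the random system is $\mathcal{E}P(x)=P(x)+x(p\log z+q\log w)$, and $$\delta_\Lambda=\inf\{x\in\mathbb{R}:\mathcal{E}P(x)\le0\}.$$ Counting function. For $\rho\in E_A^{\mathbb{N}}$, $\lambda\in\Lambda$ and $T>0$, $$N_\rho^\lambda(T)=\#\{\omega\in E_\rho^*: S_{|\omega|}f(\omega\rho,\lambda)\ge -T\}.$$ *)

(* Defs.v *)
From HB Require Import structures.
From mathcomp Require Import all_boot all_order all_algebra.
From mathcomp Require Import all_classical all_reals all_analysis.

Set Implicit Arguments.
Unset Strict Implicit.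
Unset Printing Implicit Defensive.

Import Order.TTheory GRing.Theory Num.Theory.
Import numFieldNormedType.Exports.

Local Open Scope classical_set_scope.
Local Open Scope ring_scope.

(* Sequences are indexed from 0: [rho i] is the letter usually written
   rho_{i+1}. *)
Definition admissible (E : finType) (A : rel E) : set (nat -> E) :=
  [set rho | forall i : nat, A (rho i) (rho i.+1)].

(* The word w between e and e' may be empty. *)
Definition irreducible_incidence (E : finType) (A : rel E) : Prop :=
  forall e e' : E, exists w : seq E, path A e (rcons w e').

Definition shift (E : Type) (rho : nat -> E) : nat -> E := fun i => rho i.+1.

Definition scons (E : Type) (e : E) (rho : nat -> E) : nat -> E :=
  fun i => if i is j.+1 then rho j else e.

Definition scat (E : Type) (w : seq E) (rho : nat -> E) : nat -> E :=
  foldr (@scons E) rho w.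

Definition cylinder (E : finType) (A : rel E) (w : seq E) : set (nat -> E) :=
  [set rho | admissible A rho /\ mkseq rho (size w) = w].

Definition words_before (E : finType) (A : rel E) (rho : nat -> E) :
    set (seq E) :=
  [set w | [/\ w != [::], sorted A w & admissible A (scat w rho)]].

Definition phi (R : realType) (E : Type) (alpha beta : E -> R) (e : E) (t : R) :
  R := alpha e * t + beta e.

(* log |phi'_{rho_1}|, the derivative of phi_e being the positive constant
   alpha_e. *)
Definition potential (R : realType) (E : Type) (alpha : E -> R)
  (rho : nat -> E) : R := ln (alpha (rho 0%N)).

Definition ergodic_sum (R : realType) (E : Type) (f : (nat -> E) -> R)
  (n : nat) (rho : nat -> E) : R := \sum_(i < n) f (iter i (@shift E) rho).

(* The pressure of f, as an extended real.  The [sup] is the real supremum, as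
   S_n f takes finitely many values for a potential depending on one letter. *)
Definition pressure (R : realType) (E : finType) (A : rel E)
    (f : (nat -> E) -> R) (x : R) : \bar R :=
  limn (fun n : nat =>
    ((n%:R)^-1 *
     ln (\sum_(w : n.-tuple E | sorted A w)
           expR (x * sup (ergodic_sum f n @` cylinder A w))))%:E).

Definition strongly_regular (R : realType) (E : finType) (A : rel E)
    (f : (nat -> E) -> R) : Prop :=
  (exists2 x : R, 0 < x & pressure A f x = 0%E) /\
  (exists2 x : R, 0 < x & (0 < pressure A f x < +oo)%E).

(* seq_sub [:: z; w] is the subtype {z, w} of R. *)
Definition letter (R : realType) (z w : R) : Type := seq_sub [:: z; w].

HB.instance Definition _ (R : realType) (z w : R) :=
  Finite.on (letter z w).
HB.instance Definition _ (R : realType) (z w : R) :=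
  isPointed.Build (letter z w) (SeqSub (mem_head z [:: w])).

Definition coordinate_sets (R : realType) (z w : R) :
    set (set (int -> letter z w)) :=
  [set C | exists (i : int) (a : letter z w), C = [set lam | lam i = a]].

(* {z, w}^Z with its product sigma-algebra. *)
Notation Lambda z w := (g_sigma_algebraType (@coordinate_sets _ z w)).

(* nu is the product measure with nu[lambda_0 = z] = p, nu[lambda_0 = w] = q:
   this gives its value on all finite-dimensional cylinders, hence
   determines it. *)
Definition is_bernoulli (R : realType) (z w p q : R)
    (nu : probability (Lambda z w) R) : Prop :=
  forall (s : seq int) (a : int -> letter z w), uniq s ->
    nu [set lam : Lambda z w | forall i, i \in s -> lam i = a i] =
    (\prod_(i <- s) (if ssval (a i) == z then p else q))%:E.

(* The ergodic sum of the random potential (rho, lam) |-> log (alpha_{rho_1}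
   lam_0), that of the system lam_0 phi_e, along the shift in both
   variables. *)
Definition random_ergodic_sum (R : realType) (E : Type) (alpha : E -> R)
    (z w : R) (n : nat) (rho : nat -> E) (lam : Lambda z w) : R :=
  ergodic_sum (potential alpha) n rho +
  ln `|\prod_(i < n) ssval (lam (Posz i))|.

Definition expected_pressure (R : realType) (E : finType) (A : rel E)
    (alpha : E -> R) (z w p q : R) (x : R) : \bar R :=
  (pressure A (potential alpha) x + (x * (p * ln z + q * ln w))%:E)%E.

Definition delta_Lambda (R : realType) (E : finType) (A : rel E)
    (alpha : E -> R) (z w p q : R) : R :=
  inf [set x : R | (expected_pressure A alpha z w p q x <= 0)%E].

(* [counting] is the cardinality of a set, +oo if the set is infinite. *)
Definition counting_function (R : realType) (E : finType) (A : rel E)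
    (alpha : E -> R) (z w : R) (rho : nat -> E) (lam : Lambda z w) (T : R) :
    \bar R :=
  counting [set u | words_before A rho u /\
    - T <= random_ergodic_sum alpha (size u) (scat u rho) lam].

(* Main.v *)
(* Since alpha_0 = alpha_1 = a, the random ergodic sum of a word depends only on
   its length n: it is - Y_n with Y_n = n mu - W_n, where mu > 0 is its mean
   decay and W_n is the centered random walk with steps
   ln lambda_i - (p ln z + q ln w).  The number of admissible words of length n
   is r ^ n up to a bounded factor, r being the Perron eigenvalue of A, so that
   P(x) = ln r + x ln a and delta_Lambda = ln r / mu.  Hence
   N(Y_n) exp (- delta_Lambda Y_n) equals exp (delta_Lambda W_n) up to a bounded
   factor, and the claim reduces to the almost sure unboundedness of W_n, above
   and below.  Strong regularity forces r > 1.

   Unboundedness is obtained by comparing the probability that the walk stays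
   below a level during n steps with an affine, hence harmonic, function. *)

Require Import Defs.
From HB Require Import structures.
From mathcomp Require Import all_boot all_order all_algebra.
From mathcomp Require Import all_classical all_reals all_analysis.
From mathcomp Require Import finmap ring lra.

Set Implicit Arguments.
Unset Strict Implicit.
Unset Printing Implicit Defensive.

Import Order.TTheory GRing.Theory Num.Theory.
Import numFieldNormedType.Exports.

Local Open Scope classical_set_scope.
Local Open Scope ring_scope.

(** * Centered two-step walks *)

(** The probability that a walk started at [x], with steps [d1] and [d2] of probabilities [p] and
    [q], is at most [c] at all times 0 to [n]. The recursion conditions on the first step, so it can
    be estimated without measure theory. *)
Fixpoint stay_prob (R : realType) (p q d1 d2 c : R) (n : nat) (x : R) : R :=
  if x <= c then
    if n is m.+1 then
      p * stay_prob p q d1 d2 c m (x + d1) +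
      q * stay_prob p q d1 d2 c m (x + d2)
    else 1
  else 0.

Lemma stay_prob_le1 (R : realType) (p q d1 d2 c : R) n x :
  0 <= p -> 0 <= q -> p + q = 1 -> stay_prob p q d1 d2 c n x <= 1.
Proof.
move=> p0 q0 pq; elim: n x => [|n IH] x /=; case: ifP => // _.
by rewrite -pq lerD// ler_piMr.
Qed.

Lemma stay_prob_swap (R : realType) (p q d1 d2 c : R) n x :
  stay_prob p q d1 d2 c n x = stay_prob q p d2 d1 c n x.
Proof.
by elim: n x => [|n IH] x //=; case: ifP => // _; rewrite !IH addrC.
Qed.

(* The affine function vanishing at c + d1 is harmonic for the walk, and it is
   at least 1 below the level c - K d1; from the strip above that level the
   walk leaves by K up-steps with probability p ^ K. *)
Lemma stay_prob_barrier (R : realType) (p q d1 d2 c : R) (K m : nat) (x : R) :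
  0 < p -> 0 < q -> p + q = 1 -> p * d1 + q * d2 = 0 -> 0 < d1 ->
  x <= c + d1 ->
  stay_prob p q d1 d2 c (m * K) x <=
    (c + d1 - x) / (K.+1%:R * d1) + (1 - p ^+ K) ^+ m.
Proof.
move=> p0 q0 pq pd d10.
have p1 : p <= 1 by lra.
have d20 : d2 <= 0.
  by rewrite -(pmulr_rle0 _ q0) -(lerD2l (p * d1)) pd addr0 mulr_ge0 ?ltW.
set u := stay_prob p q d1 d2 c.
(* Normalised to be 0 at [c + d1] and 1 at [c - K d1]. One step from below [c] never passes
   [c + d1], so [l] is nonnegative wherever the walk can be. *)
pose l (y : R) := (c + d1 - y) / (K.+1%:R * d1).
have e0 : 0 < K.+1%:R * d1 by rewrite mulr_gt0 ?ltr0n.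
have l_ge0 (y : R) : y <= c + d1 -> 0 <= l y.
  by move=> yc; rewrite /l divr_ge0 ?subr_ge0 ?(ltW e0).
have l_harm y : p * l (y + d1) + q * l (y + d2) = l y.
  rewrite /l !mulrA -mulrDl; congr (_ / _).
  transitivity ((p + q) * (c + d1 - y) - (p * d1 + q * d2)); first by ring.
  by rewrite pd pq; ring.
have out n y : c < y -> u n y = 0.
  by rewrite /u ltNge; case: n => [|n] /= /negbTE ->.
pose B n (D : R) := forall y : R, y <= c + d1 -> u n y - l y <= D.
have step n y : y <= c -> u n.+1 y - l y =
    p * (u n (y + d1) - l (y + d1)) + q * (u n (y + d2) - l (y + d2)).
  by move=> yc; rewrite -l_harm /u /= yc; ring.
have up y : y <= c -> y + d1 <= c + d1 by rewrite lerD2r.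
have down y : y <= c -> y + d2 <= c + d1 by move=> ?; lra.
(* Maximum principle: below [c] the new excess of [u] over [l] is an average of old ones, and above
   [c] it is nonpositive. *)
have BS n (D : R) : 0 <= D -> B n D -> B n.+1 D.
  move=> D0 BD y yc; have [yc'|cy] := leP y c; last first.
    by rewrite out// sub0r (le_trans _ D0)// oppr_le0 l_ge0.
  rewrite step// -[leRHS]mul1r -pq mulrDl lerD// ler_wpM2l ?(ltW p0) ?(ltW q0)// BD ?up ?down//.
have Bn n j (D : R) : 0 <= D -> B n D -> B (j + n)%N D.
  by move=> D0 BD; elim: j => // j IH; apply: BS.
have BK n (D : R) : 0 <= D -> B n D -> B (K + n)%N ((1 - p ^+ K) * D).
  move=> D0 hB.
  (* If [j] up-steps pass [c], that run has probability [p ^ j] and ends with a nonpositive excess;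
     only the remaining mass carries [D]. *)
  have esc j (y : R) : y <= c + d1 -> c < y + j%:R * d1 ->
      u (j + n)%N y - l y <= (1 - p ^+ j) * D.
    elim: j y => [|j IH] y yc.
      by rewrite mul0r addr0 expr0 subrr mul0r => /out ->; rewrite sub0r oppr_le0 l_ge0.
    have [yc' cj|cy _] := leP y c; last first.
      rewrite out// sub0r (@le_trans _ _ 0) ?oppr_le0 ?l_ge0// mulr_ge0//.
      by rewrite subr_ge0 exprn_ile1// ltW.
    rewrite addSn step//.
    have -> : (1 - p ^+ j.+1) * D = p * ((1 - p ^+ j) * D) + q * D.
      by rewrite exprS -[X in X - _]pq; ring.
    apply: lerD; rewrite ler_wpM2l ?(ltW p0) ?(ltW q0)//.
      rewrite IH ?up//.
      by rewrite (lt_le_trans cj)// -natr1; lra.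
    by apply: Bn; rewrite ?down.
  (* In the second case [y <= c - K d1], where [l y >= 1] already dominates the probability. *)
  move=> y yc; have [|cK] := ltP c (y + K%:R * d1); first exact: esc.
  have DD : 0 <= (1 - p ^+ K) * D.
    by rewrite mulr_ge0// subr_ge0 exprn_ile1// ltW.
  rewrite (le_trans _ DD)// subr_le0.
  rewrite (le_trans (stay_prob_le1 _ _ _ _ _ (ltW p0) (ltW q0) pq))//.
  by rewrite /l ler_pdivlMr// -natr1; lra.
have Bm : B (m * K)%N ((1 - p ^+ K) ^+ m).
  elim: m => [|m IH]; last first.
    by rewrite mulSn exprS; apply: BK => //; rewrite exprn_ge0// subr_ge0 exprn_ile1// ltW.
  move=> y yc; rewrite expr0 lerBlDr (le_trans (stay_prob_le1 _ _ _ _ _ (ltW p0) (ltW q0) pq))//.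
  by rewrite lerDl l_ge0.
by move=> xc; rewrite -lerBlDl Bm.
Qed.

Lemma stay_prob_small (R : realType) (p q d1 d2 c x e : R) :
  0 < p -> 0 < q -> p + q = 1 -> p * d1 + q * d2 = 0 -> d1 != 0 -> 0 < e ->
  exists n, stay_prob p q d1 d2 c n x <= e.
Proof.
(* A centered walk with nonzero [d1] has exactly one positive step; exchanging the roles makes it
   [d1]. *)
wlog d10 : p q d1 d2 / 0 < d1 => [hw|].
  move=> p0 q0 pq pd; rewrite neq_lt => /orP[dn|dp] e0; last first.
    by apply: (hw p q d1 d2) => //; rewrite gt_eqF.
  have d20 : 0 < d2.
    by rewrite -(pmulr_rgt0 _ q0) -(ltrD2l (p * d1)) pd addr0 pmulr_rlt0.
  have [|||n] := hw q p d2 d1 d20 q0 p0 _ _ _ e0.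
  - by rewrite addrC.
  - by rewrite addrC.
  - by rewrite gt_eqF.
  by rewrite -stay_prob_swap; exists n.
move=> p0 q0 pq pd _ e0.
have [xc|cx] := leP x (c + d1); last first.
  by exists 0%N => /=; rewrite [x <= c]leNgt (lt_trans _ cx) ?ltrDl//= ltW.
(* [K] is fixed first, to make the affine term small; then [m] is taken large for the geometric
   term. *)
have [K hK] : exists K : nat, (c + d1 - x) / (K.+1%:R * d1) <= e / 2.
  exists (Num.truncn ((c + d1 - x) / (d1 * (e / 2)))).
  rewrite ler_pdivrMr ?mulr_gt0 ?ltr0n//.
  have := truncnS_gt ((c + d1 - x) / (d1 * (e / 2))).
  rewrite ltr_pdivrMr ?mulr_gt0 ?divr_gt0// => /ltW/le_trans; apply.
  by rewrite le_eqVlt; apply/orP; left; apply/eqP; ring.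
have pK : 0 < p ^+ K by rewrite exprn_gt0.
have pK1 : p ^+ K <= 1 by rewrite exprn_ile1 ?ltW//; lra.
have : (fun m => (1 - p ^+ K) ^+ m) @ \oo --> 0.
  apply: cvg_expr; rewrite ger0_norm ?subr_ge0//; lra.
move/cvgr_lt => /(_ (e / 2)); rewrite divr_gt0// => /(_ isT)[m _ /(_ m (leqnn m))/= hm].
exists (m * K)%N; apply: le_trans (stay_prob_barrier K m p0 q0 pq pd d10 xc) _.
by rewrite (splitr e) lerD// ltW.
Qed.

(** * Stay probabilities under the Bernoulli measure *)

Definition letter_z (R : realType) (z w : R) : letter z w :=
  SeqSub (mem_head z [:: w]).

Definition letter_w (R : realType) (z w : R) : letter z w :=
  SeqSub (mem_last z [:: w]).

Lemma letterP (R : realType) (z w : R) (e : letter z w) :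
  e = letter_z z w \/ e = letter_w z w.
Proof.
case: e => x xP; have := xP; rewrite !inE => /orP[]/eqP xE.
- by left; apply: val_inj.
- by right; apply: val_inj.
Qed.

(** The start index [k] is a parameter because removing the first step leaves a walk that reads from
    coordinate [k + 1]. *)
Definition walk (R : realType) (z w : R) (d : letter z w -> R)
    (k n : nat) (lam : Lambda z w) : R :=
  \sum_(i < n) d (lam (Posz (k + i))).

Lemma walkS (R : realType) (z w : R) (d : letter z w -> R) k n
    (lam : Lambda z w) :
  walk d k n.+1 lam = d (lam (Posz k)) + walk d k.+1 n lam.
Proof.
rewrite /walk big_ord_recl addn0; congr (_ + _).
by apply: eq_bigr => i _; rewrite /bump /= addnA addn1.
Qed.

Lemma coordinate_measurable (R : realType) (z w : R) (i : int) (b : letter z w) :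
  measurable [set lam : Lambda z w | lam i = b].
Proof. by apply: sub_sigma_algebra; exists i, b. Qed.

Definition cylinder_on (R : realType) (z w : R) (b : nat -> letter z w) (k : nat) :
    set (Lambda z w) :=
  [set lam | forall i : nat, (i < k)%N -> lam (Posz i) = b i].

Definition stay (R : realType) (z w : R) (d : letter z w -> R) (c : R)
    (k n : nat) (x : R) : set (Lambda z w) :=
  [set lam | forall j, (j <= n)%N -> x + walk d k j lam <= c].

Lemma measurable_prefix (R : realType) (z w : R) (b : nat -> letter z w) k :
  measurable (cylinder_on b k).
Proof.
rewrite (_ : cylinder_on b k =
  \bigcap_(i in [set i | (i < k)%N]) [set lam : Lambda z w | lam (Posz i) = b i]) //.
by apply: bigcap_measurableType => // i _; apply: coordinate_measurable.
Qed.

Lemma prefix_prob (R : realType) (z w p q : R) (nu : probability (Lambda z w) R)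
    (b : nat -> letter z w) k :
  is_bernoulli p q nu ->
  nu (cylinder_on b k) = (\prod_(i < k) (if ssval (b i) == z then p else q))%:E.
Proof.
move=> hnu; pose s : seq int := [seq Posz i | i <- iota 0 k].
have us : uniq s by rewrite map_inj_uniq ?iota_uniq// => i j [].
have := hnu s (fun i => b (absz i)) us.
rewrite big_map -[X in iota X]/(0%N) -[k in iota 0 k]subn0 -/(index_iota 0 k).
rewrite big_mkord /= => <-; congr (nu _); apply/seteqP; split => lam /= h i.
- by case/mapP => j; rewrite mem_iota /= add0n => jk ->; apply: h.
- by move=> ik; rewrite (h (Posz i))//; apply: map_f; rewrite mem_iota.
Qed.

(** Induction on [n], splitting by the letter at coordinate [k]. Prescribing the first [k] letters
    makes both pieces instances of the induction hypothesis, so independence enters only through the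
    product formula for cylinders. Measurability is carried along because additivity requires it. *)
Lemma stay_probE (R : realType) (z w p q : R) (nu : probability (Lambda z w) R)
    (d : letter z w -> R) (c : R) (b : nat -> letter z w) k n x :
  z != w -> is_bernoulli p q nu ->
  measurable (cylinder_on b k `&` stay d c k n x) /\
  nu (cylinder_on b k `&` stay d c k n x) =
    (\prod_(i < k) (if ssval (b i) == z then p else q) *
     stay_prob p q (d (letter_z z w)) (d (letter_w z w)) c n x)%:E.
Proof.
move=> zw hnu; elim: n k x b => [|n IH] k x b.
  have [xc|cx] := leP x c.
    rewrite (_ : stay d c k 0 x = setT) ?setIT; last first.
      by apply/seteqP; split=> // lam _ [|//] _; rewrite /walk big_ord0 addr0.
    by split; [exact: measurable_prefix|rewrite (prefix_prob _ _ hnu)/= xc mulr1].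
  rewrite (_ : stay d c k 0 x = set0) ?setI0.
    by rewrite measure0/= leNgt cx mulr0.
  apply/seteqP; split=> // lam /(_ 0%N isT).
  by rewrite /walk big_ord0 addr0 leNgt cx.
have [xc|cx] := leP x c; last first.
  rewrite (_ : stay d c k n.+1 x = set0) ?setI0.
    by rewrite measure0/= leNgt cx mulr0.
  apply/seteqP; split=> // lam /(_ 0%N isT).
  by rewrite /walk big_ord0 addr0 leNgt cx.
pose ext (e : letter z w) i := if (i < k)%N then b i else e.
have split_next : cylinder_on b k `&` stay d c k n.+1 x =
    (cylinder_on (ext (letter_z z w)) k.+1 `&` stay d c k.+1 n (x + d (letter_z z w))) `|`
    (cylinder_on (ext (letter_w z w)) k.+1 `&` stay d c k.+1 n (x + d (letter_w z w))).
  apply/seteqP; split=> lam.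
    move=> [hb hs].
    have next e : lam (Posz k) = e ->
        cylinder_on (ext e) k.+1 lam /\ stay d c k.+1 n (x + d e) lam.
      move=> lk; split=> [i|j jn].
        rewrite ltnS leq_eqVlt /ext => /orP[/eqP->|ik]; first by rewrite ltnn.
        by rewrite ik hb.
      by have := hs j.+1 jn; rewrite walkS lk addrA.
    by have [lk|lk] := letterP (lam (Posz k)); [left|right]; apply: next.
  have prev e : cylinder_on (ext e) k.+1 lam /\ stay d c k.+1 n (x + d e) lam ->
      cylinder_on b k lam /\ stay d c k n.+1 x lam.
    move=> [hb hs]; split=> [i ik|[_|j jn]].
    - by rewrite hb /ext ?ik// ltnS ltnW.
    - by rewrite /walk big_ord0 addr0.
    - by rewrite walkS hb /ext// ltnn addrA; apply: hs.
  by move=> [/prev|/prev].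
have [mz pz] := IH k.+1 (x + d (letter_z z w)) (ext (letter_z z w)).
have [mw pw] := IH k.+1 (x + d (letter_w z w)) (ext (letter_w z w)).
rewrite split_next; split; first exact: measurableU.
rewrite measureU//; last first.
  apply/seteqP; split=> // lam [[hz _] [hw _]].
  have := hw k (leqnn _); rewrite hz// /ext ltnn => /(congr1 val)/= /eqP.
  by rewrite (negbTE zw).
have ext_prod e : \prod_(i < k.+1) (if ssval (ext e i) == z then p else q) =
    \prod_(i < k) (if ssval (b i) == z then p else q) *
    (if ssval e == z then p else q).
  rewrite big_ord_recr/= /ext ltnn; congr (_ * _).
  by apply: eq_bigr => i _; rewrite ltn_ord.
rewrite [X in (X + _)%E = _]pz [X in (_ + X)%E = _]pw -EFinD /= xc; congr EFin.
by rewrite !ext_prod /= eqxx eq_sym (negbTE zw); ring.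
Qed.

(** For a fixed level the exceptional event lies in every [S n], whose measure is a stay probability
    and becomes arbitrarily small. Restricting to integer levels leaves a countable union of null
    sets. *)
Lemma walk_unbounded (R : realType) (z w p q : R)
    (nu : probability (Lambda z w) R) (d : letter z w -> R) :
  z != w -> 0 < p -> 0 < q -> p + q = 1 -> is_bernoulli p q nu ->
  p * d (letter_z z w) + q * d (letter_w z w) = 0 -> d (letter_z z w) != 0 ->
  {ae nu, forall lam, forall c : nat, exists n, c%:R < walk d 0 n lam}.
Proof.
move=> zw p0 q0 pq hnu pd dz; apply: ae_foralln => c.
pose S n := stay d c%:R 0 n 0.
have SE n : measurable (S n) /\
    nu (S n) = (stay_prob p q (d (letter_z z w)) (d (letter_w z w)) c%:R n 0)%:E.
  have [] := stay_probE d c%:R (fun=> letter_z z w) 0 n 0 zw hnu.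
  rewrite big_ord0 mul1r.
  rewrite (_ : cylinder_on _ _ = setT) ?setTI//.
  by apply/seteqP; split => // lam _ i.
exists (\bigcap_n S n); split.
- by apply: bigcap_measurableType => // n _; case: (SE n).
- apply/eqP; rewrite eq_le measure_ge0 andbT; apply/lee_addgt0Pr => e e0.
  rewrite add0e.
  have [n hn] := stay_prob_small c%:R 0 p0 q0 pq pd dz e0.
  have [mn nuE] := SE n.
  apply: (@le_trans _ _ (nu (S n))); last by rewrite nuE lee_fin.
  apply: le_measure; [apply: mem_set|exact: mem_set|exact: bigcap_inf].
  by apply: bigcap_measurableType => m _; case: (SE m).
- move=> lam /= nex n _ j _; rewrite add0r leNgt; apply/negP => cj.
  by apply: nex; exists j.
Qed.

(** * Path counts and pressure *)

(** The row sum at [e] of the [n]-th power of [A]: [n] counts steps, so [e] itself is not among the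
    [n] letters. *)
Definition path_count (E : finType) (A : rel E) (e : E) (n : nat) : nat :=
  #|[pred t : n.-tuple E | path A e t]|.

Lemma card_tupleS (E : finType) (P : pred (seq E)) n :
  #|[pred t : n.+1.-tuple E | P t]| =
  (\sum_(e : E) #|[pred t : n.-tuple E | P (e :: t)]|)%N.
Proof.
rewrite -sum1_card.
rewrite (reindex (fun et : E * n.-tuple E => cons_tuple et.1 et.2)) /=; last first.
  exists (fun t => (thead t, behead_tuple t)) => [[e t] _|t _] /=.
    by congr (_, _); apply: val_inj.
  by apply: val_inj; rewrite /= [in RHS](tuple_eta t).
under [RHS]eq_bigr do rewrite -sum1_card.
by rewrite pair_big_dep /=; apply: eq_bigl => -[e t].
Qed.

Lemma path_count0 (E : finType) (A : rel E) e : path_count A e 0 = 1%N.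
Proof.
rewrite /path_count (eq_card (B := predT)) ?card_tuple// => t.
by rewrite !inE tuple0.
Qed.

Lemma path_countS (E : finType) (A : rel E) e n :
  path_count A e n.+1 = (\sum_(e' | A e e') path_count A e' n)%N.
Proof.
rewrite /path_count (card_tupleS (path A e)) [RHS]big_mkcond /=.
apply: eq_bigr => e' _; case: ifP => _.
  by apply: eq_card => t; rewrite !inE.
by apply: eq_card0 => t; rewrite !inE.
Qed.

Lemma sorted_countS (E : finType) (A : rel E) n :
  #|[pred t : n.+1.-tuple E | sorted A t]| = (\sum_e path_count A e n)%N.
Proof. by rewrite (card_tupleS (sorted A)). Qed.

(* A positive eigenvector v of A, with eigenvalue r, is invariant under the
   recursion satisfied by the path counts. *)
Lemma path_count_growth (R : realFieldType) (E : finType) (A : rel E)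
    (v : E -> R) (r : R) :
  0 < r -> (forall e, 0 < v e) ->
  (forall e, \sum_(e' | A e e') v e' = r * v e) ->
  exists2 D : R, 0 < D &
    forall e n, D^-1 * r ^+ n <= (path_count A e n)%:R <= D * r ^+ n.
Proof.
move=> r0 v0 vE.
have [[e0]|noE] := pselect (inhabited E); last first.
  by exists 1 => // e; exfalso; apply: noE.
(* Chosen so that [v e / s <= 1 <= t * v e] for every letter, which is the case [n = 0] of the
   bounds. *)
pose s := \sum_e v e; pose t := \sum_e (v e)^-1.
have vs e : v e <= s.
  by rewrite /s (bigD1 e)//= lerDl sumr_ge0// => i _; rewrite ltW.
have vt e : 1 <= t * v e.
  rewrite /t (bigD1 e)//= mulrDl mulVf ?gt_eqF// lerDl mulr_ge0 ?(ltW (v0 e))//.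
  by rewrite sumr_ge0// => i _; rewrite invr_ge0 ltW.
have s0 : 0 < s by apply: lt_le_trans (vs e0).
have t0 : 0 < t by rewrite -(pmulr_lgt0 _ (v0 e0)) (lt_le_trans ltr01).
have growth e n : s^-1 * r ^+ n * v e <= (path_count A e n)%:R <= t * r ^+ n * v e.
  elim: n e => [|n IH] e.
    by rewrite path_count0 !expr0 !mulr1 vt ler_pdivrMl ?mulr1 ?vs.
  rewrite path_countS natr_sum.
  have fac c : c * r ^+ n.+1 * v e = \sum_(e' | A e e') c * r ^+ n * v e'.
    by rewrite -mulr_sumr vE exprS; ring.
  by rewrite !fac; apply/andP; split; apply: ler_sum => e' _; case/andP: (IH e').
have rn n : 0 <= r ^+ n by rewrite exprn_ge0 ?ltW.
exists (s * t) => [|e n]; first by rewrite mulr_gt0.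
case/andP: (growth e n) => lo hi; apply/andP; split.
  apply: le_trans lo; rewrite invfM mulrAC; apply: ler_wpM2l.
    by rewrite mulr_ge0// invr_ge0 ltW.
  by rewrite -[t^-1]mulr1 ler_pdivrMl.
apply: le_trans hi _; rewrite [leLHS]mulrAC ler_wpM2r//.
by rewrite [leRHS]mulrC ler_wpM2l ?(ltW t0).
Qed.

(** * Irreducible matrices on two letters *)

Lemma ord2P (e : 'I_2) : e = ord0 \/ e = ord_max.
Proof. by case: e => [[|[|//]] h]; [left|right]; apply: val_inj. Qed.

(** A path from [e] to [e'] must leave [e] at some step, and with two letters that step goes to
    [e']. *)
Lemma irreducible_offdiag (A : rel 'I_2) (e e' : 'I_2) :
  irreducible_incidence A -> e != e' -> A e e'.
Proof.
move=> /(_ e e')[w] hw ee'; elim: w hw => /= [|x w IH]; first by rewrite andbT.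
case/andP=> ex; have [->|xe] := eqVneq x e; first exact: IH.
suff -> : e' = x by [].
by move: ee' xe; case: (ord2P e) (ord2P e') (ord2P x) => -> [] -> [] ->.
Qed.

(** Both off-diagonal entries are 1. Symmetry later allows words in front of [rho] to be read
    backwards. *)
Lemma irreducible_sym (A : rel 'I_2) : irreducible_incidence A -> symmetric A.
Proof.
move=> irrA e e'; have [->//|ee'] := eqVneq e e'.
by rewrite (irreducible_offdiag irrA ee') (irreducible_offdiag irrA)// eq_sym.
Qed.

(** The matrix has diagonal [s], [t] and off-diagonal entries 1. Its larger eigenvalue [r] solves
    [(r - s) * (r - t) = 1], with eigenvector [(1, r - s)]. *)
Lemma irreducible_perron (R : rcfType) (A : rel 'I_2) :
  irreducible_incidence A ->
  exists (r : R) (v : 'I_2 -> R), [/\ 0 < r, forall e, 0 < v e &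
    forall e, \sum_(e' | A e e') v e' = r * v e].
Proof.
move=> irrA.
have A01 : A ord0 ord_max by exact: irreducible_offdiag.
have A10 : A ord_max ord0 by exact: irreducible_offdiag.
pose s : R := (A ord0 ord0)%:R; pose t : R := (A ord_max ord_max)%:R.
pose D := Num.sqrt ((s - t) ^+ 2 + 4).
have s0 : 0 <= s by exact: ler0n.
have arg0 : 0 <= (s - t) ^+ 2 + 4 by rewrite addr_ge0 ?sqr_ge0.
have D2 : D ^+ 2 = (s - t) ^+ 2 + 4 by exact: sqr_sqrtr arg0.
have D0 : 0 <= D by exact: sqrtr_ge0.
(* This is twice [r - s], the second entry of the eigenvector. *)
have gap : 0 < t - s + D.
  have [st|ts] := ltP s t.
    by rewrite ltr_pwDl// subr_gt0.
  rewrite -[t - s]opprB addrC subr_gt0 -ltr_sqr ?nnegrE ?subr_ge0// D2.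
  by rewrite ltrDl.
pose r := (s + t + D) / 2.
have r_char : 1 + t * (r - s) = r * (r - s).
  have : r * (r - s) - t * (r - s) = (D ^+ 2 - (s - t) ^+ 2) / 4.
    by rewrite /r; field.
  rewrite D2 => h; suff : r * (r - s) - t * (r - s) = 1 by lra.
  by rewrite h; field.
have rs : 0 < r - s by rewrite /r; lra.
exists r, (fun e => if e == ord0 then 1 else r - s); split.
- lra.
- by move=> e; case: ifP.
move=> e; rewrite big_mkcond !big_ord_recl big_ord0 /= addr0.
rewrite (_ : lift ord0 ord0 = ord_max); last exact: val_inj.
rewrite /=; have [->|->] := ord2P e; rewrite ?A01 ?A10 /=.
  by rewrite mulr1 -/s; rewrite /s; case: (A ord0 ord0) => /=; ring.
by rewrite -r_char /t; case: (A ord_max ord_max) => /=; ring.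
Qed.

(** * The pressure for equal contraction ratios *)

(** Ensures that the supremum in the pressure is over a nonempty set, hence is not a default
    value. *)
Lemma cylinder_nonempty (E : finType) (A : rel E) (w : seq E) :
  w != [::] -> (forall e, exists e', A e e') -> sorted A w -> cylinder A w !=set0.
Proof.
move=> wn0 /choice[f Af] sw.
have [e0] : inhabited E by case: w wn0 {sw}.
have w_gt0 : (0 < size w)%N by rewrite lt0n size_eq0.
(* Inside the word the truncated difference is 0 and the letter of [w] is read; past its end the
   default [f (last e0 w)] is iterated further by the successor map [f]. *)
pose rho i := iter (i - size w)%N f (nth (f (last e0 w)) w i).
exists rho; split; last first.
  apply: (@eq_from_nth _ e0); rewrite size_mkseq// => i iw.
  rewrite nth_mkseq// /rho (_ : (i - size w = 0)%N) /=.
    exact: set_nth_default.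
  by apply/eqP; rewrite subn_eq0 ltnW.
move=> i; rewrite /rho; have [iw|wi] := ltnP i.+1 (size w).
  have /eqP -> : (i - size w == 0)%N by rewrite subn_eq0 ltnW// ltnW.
  have /eqP -> : (i.+1 - size w == 0)%N by rewrite subn_eq0 ltnW.
  by move/(sortedP (f (last e0 w))): sw => /(_ i iw).
rewrite [nth _ _ i.+1]nth_default//; have [iw|{}wi] := ltnP i (size w).
  have wE : size w = i.+1 by apply/eqP; rewrite eqn_leq wi.
  have /eqP -> : (i - size w == 0)%N by rewrite subn_eq0 ltnW.
  rewrite wE subnn /= (set_nth_default e0)//.
  by rewrite (_ : i = (size w).-1) ?nth_last ?wE//; apply: Af.
by rewrite subSn// nth_default//=; apply: Af.
Qed.

Lemma ergodic_sum_const (R : realType) (E : Type) (alpha : E -> R) (a : R) n rho :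
  (forall e, alpha e = a) ->
  ergodic_sum (potential alpha) n rho = ln a *+ n.
Proof.
move=> alphaE; rewrite /ergodic_sum (eq_bigr (fun=> ln a)).
  by rewrite sumr_const card_ord.
by move=> i _; rewrite /potential alphaE.
Qed.

(** All words of length [n] have the same weight, so the sum is a word count times [a ^ n] to the
    power [x]. The count is [r ^ n] up to a bounded factor, which disappears after taking logarithms
    and dividing by [n]. *)
Lemma pressure_const (R : realType) (E : finType) (A : rel E)
    (alpha v : E -> R) (a r x : R) :
  E -> (forall e, alpha e = a) -> 0 < r -> (forall e, 0 < v e) ->
  (forall e, \sum_(e' | A e e') v e' = r * v e) ->
  pressure A (potential alpha) x = (ln r + x * ln a)%:E.
Proof.
move=> e0 alphaE r0 v0 vE.
(* A zero row would contradict the positivity of [r * v e]. *)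
have Anext e : exists e', A e e'.
  apply/existsP; rewrite -[X in is_true X]negbK; apply/negP => /existsPn noe.
  have : 0 < r * v e by rewrite mulr_gt0.
  by rewrite -vE big1 ?ltxx// => e' ee'; case/negP: (noe e').
have [D D0 HD] := path_count_growth r0 v0 vE.
pose cnt n := #|[pred t : n.-tuple E | sorted A t]|.
have cntE n : \sum_(w : n.+1.-tuple E | sorted A w)
    expR (x * sup (ergodic_sum (potential alpha) n.+1 @` cylinder A w)) =
    (cnt n.+1)%:R * expR (x * (ln a *+ n.+1)).
  rewrite /cnt -sum1_card natr_sum mulr_suml.
  apply: eq_big => [w|w sw]; first by rewrite inE.
  rewrite mul1r; congr (expR (_ * _)).
  rewrite (_ : _ @` _ = [set ln a *+ n.+1]) ?sup1//.
  have [rho rhow] : cylinder A w !=set0.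
    by apply: cylinder_nonempty => //; rewrite -size_eq0 size_tuple.
  apply/seteqP; split=> [_ [rho' _ <-]|_ ->] /=.
    by rewrite (ergodic_sum_const _ _ alphaE).
  by exists rho => //; rewrite (ergodic_sum_const _ _ alphaE).
(* Words with [n + 1] letters are paths of [n] steps, whence the factor [r^-1]; [#|E|] counts the
   possible first letters. *)
pose K : R := `|ln (D^-1 * r^-1)| + `|ln (#|E|%:R * D * r^-1)|.
have E0 : 0 < #|E|%:R :> R by rewrite ltr0n; apply/card_gt0P; exists e0.
have cnt_bound n : ln r *+ n.+1 - K <= ln (cnt n.+1)%:R <= ln r *+ n.+1 + K.
  have rn : 0 < r ^+ n.+1 by rewrite exprn_gt0.
  have rnE : r ^+ n = r^-1 * r ^+ n.+1 by rewrite exprS mulrA mulVf ?gt_eqF ?mul1r.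
  have lo : D^-1 * r^-1 * r ^+ n.+1 <= (cnt n.+1)%:R.
    rewrite -mulrA -rnE /cnt sorted_countS natr_sum (bigD1 e0)//=.
    by rewrite (le_trans (proj1 (andP (HD e0 n))))// lerDl sumr_ge0.
  have hi : (cnt n.+1)%:R <= #|E|%:R * D * r^-1 * r ^+ n.+1.
    rewrite -!mulrA -rnE /cnt sorted_countS natr_sum -sumr_const mulr_suml.
    by apply: ler_sum => e _; rewrite mul1r; case/andP: (HD e n).
  have c1 : 0 < D^-1 * r^-1 by rewrite mulr_gt0 ?invr_gt0.
  have c2 : 0 < #|E|%:R * D * r^-1 by rewrite !mulr_gt0 ?invr_gt0.
  have c0 : 0 < (cnt n.+1)%:R :> R by apply: lt_le_trans lo; rewrite mulr_gt0.
  apply/andP; split.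
    have : ln (D^-1 * r^-1 * r ^+ n.+1) <= ln (cnt n.+1)%:R.
      by rewrite ler_ln// posrE// mulr_gt0.
    apply: le_trans; rewrite lnM ?posrE// lnXn// [leRHS]addrC lerD2l lerNl.
    by rewrite /K -normrN (le_trans (ler_norm _))// lerDl.
  have : ln (cnt n.+1)%:R <= ln (#|E|%:R * D * r^-1 * r ^+ n.+1).
    by rewrite ler_ln// posrE// mulr_gt0.
  move/le_trans; apply; rewrite lnM ?posrE// lnXn// [leLHS]addrC lerD2l /K.
  by rewrite (le_trans (ler_norm _))// lerDr.
rewrite /pressure; apply: cvg_lim => //; apply: cvg_EFin; first exact: nearW.
rewrite -cvg_shiftS.
have Kcvg : K * (n.+1%:R)^-1 @[n --> \oo] --> (0 : R).
  by rewrite -[X in _ --> X](mulr0 K); apply: cvgMr; exact: cvg_harmonic.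
apply: (@squeeze_cvgr _ _ _ _
  (fun n => ln r + x * ln a - K * (n.+1%:R)^-1)
  (fun n => ln r + x * ln a + K * (n.+1%:R)^-1)).
- apply: nearW => n; rewrite /= cntE.
  have n0 : 0 < n.+1%:R :> R by rewrite ltr0n.
  have cnt0 : 0 < (cnt n.+1)%:R :> R.
    rewrite /cnt sorted_countS natr_sum (bigD1 e0)//=.
    rewrite ltr_pwDl ?sumr_ge0//; case/andP: (HD e0 n) => + _.
    by apply: lt_le_trans; rewrite mulr_gt0 ?invr_gt0 ?exprn_gt0.
  rewrite lnM ?posrE ?expR_gt0// expRK.
  case/andP: (cnt_bound n); set L := ln _%:R; rewrite -[ln r *+ _]mulr_natl -[ln a *+ _]mulr_natl.
  move=> lo hi.
  have -> : ln r + x * ln a - K / n.+1%:R =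
      (n.+1%:R)^-1 * (n.+1%:R * ln r - K + x * (n.+1%:R * ln a)).
    by field; rewrite gt_eqF.
  have -> : ln r + x * ln a + K / n.+1%:R =
      (n.+1%:R)^-1 * (n.+1%:R * ln r + K + x * (n.+1%:R * ln a)).
    by field; rewrite gt_eqF.
  by rewrite !ler_pM2l ?invr_gt0// !lerD2r lo hi.
- by rewrite -[X in _ --> X]subr0; apply: cvgB Kcvg; exact: cvg_cst.
- by rewrite -[X in _ --> X]addr0; apply: cvgD Kcvg; exact: cvg_cst.
Qed.

(** * The counting function along the levels of the ergodic sum *)

Lemma admissible_scat (E : finType) (A : rel E) (rho : nat -> E) (u : seq E) :
  admissible A rho -> admissible A (scat u rho) <-> sorted A (rcons u (rho 0%N)).
Proof.
move=> arho; elim: u => [//|e u IH].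
have head : scat u rho 0%N = head (rho 0%N) (rcons u (rho 0%N)) by case: u {IH}.
have -> : sorted A (rcons (e :: u) (rho 0%N)) =
    A e (scat u rho 0%N) && sorted A (rcons u (rho 0%N)).
  by rewrite head; case: u {IH head}.
split=> [h|/andP[eu /IH h]]; last by case.
by rewrite (h 0%N); apply/IH => i; apply: (h i.+1).
Qed.

(** By symmetry of [A], the reversal of a word in front of [rho] is a path leaving [rho 0]; such
    words are thus counted by [path_count] at a single letter. *)
Lemma words_beforeP (E : finType) (A : rel E) (rho : nat -> E) (u : seq E) :
  symmetric A -> admissible A rho ->
  words_before A rho u <-> u != [::] /\ path A (rho 0%N) (rev u).
Proof.
move=> symA arho; have rev_path : sorted A (rcons u (rho 0%N)) = path A (rho 0%N) (rev u).
  rewrite -[rcons _ _]revK rev_sorted rev_rcons /=.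
  by apply: eq_path => x y; rewrite symA.
split=> [[un _ /(admissible_scat _ arho)]|[un up]]; first by rewrite rev_path.
have su : sorted A (rcons u (rho 0%N)) by rewrite rev_path.
split=> //; last exact/admissible_scat.
move: un su {up rev_path}; case: u => //= e u _.
by rewrite rcons_path => /andP[].
Qed.

Lemma le_counting (R : realType) (T : choiceType) (X Y : set T) :
  X `<=` Y -> (counting X <= counting Y :> \bar R)%E.
Proof.
move=> XY; rewrite /counting; case: asboolP => [fX|nX]; case: asboolP => [fY|nY] //.
- by rewrite lee_fin ler_nat fsubset_leq_card// -fset_set_sub.
- by rewrite leey.
- by exfalso; apply: nX; apply: sub_finite_set fY.
Qed.

Lemma counting_seq (R : realType) (T : choiceType) (s : seq T) :
  counting [set` s] = ((size (undup s))%:R : R)%:E.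
Proof.
rewrite /counting asboolT; last exact: finite_seq.
congr (_%:R%:E); rewrite -card_fseq; congr (#|` _|).
apply/fsetP => x; rewrite in_fset_set; last exact: finite_seq.
by rewrite mem_setE inE.
Qed.

Definition reversed_paths (E : finType) (A : rel E) (e : E) (n : nat) :
    seq (seq E) :=
  [seq rev (tval t) | t <- enum [pred t : n.-tuple E | path A e t]].

Lemma mem_reversed_paths (E : finType) (A : rel E) e n (u : seq E) :
  (u \in reversed_paths A e n) = (size u == n) && path A e (rev u).
Proof.
apply/mapP/andP => [[t]|[/eqP un up]].
  by rewrite mem_enum inE => tp ->; rewrite size_rev size_tuple eqxx revK.
have ur : size (rev u) == n by rewrite size_rev un.
by exists (Tuple ur); rewrite ?mem_enum ?inE//= revK.
Qed.

Lemma size_reversed_paths (E : finType) (A : rel E) e n :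
  size (reversed_paths A e n) = path_count A e n.
Proof. by rewrite size_map -cardE. Qed.

Lemma uniq_reversed_paths (E : finType) (A : rel E) e n :
  uniq (reversed_paths A e n).
Proof.
rewrite map_inj_uniq ?enum_uniq// => t t' /(congr1 rev); rewrite !revK.
exact: val_inj.
Qed.

(** Monotonicity of [Y] turns the condition into [size u <= n]. The lower bound keeps only words of
    length [n]; the upper bound sums over all lengths up to [n], the empty word included. *)
Lemma counting_level (R : realType) (E : finType) (A : rel E) (rho : nat -> E)
    (Y : nat -> R) (n : nat) :
  symmetric A -> admissible A rho -> {mono Y : i j / (i <= j)%N >-> i <= j} ->
  (0 < n)%N ->
  (((path_count A (rho 0%N) n)%:R : R)%:E <=
    counting [set u | words_before A rho u /\ (Y (size u) <= Y n)%R] <=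
    (\sum_(k < n.+1) ((path_count A (rho 0%N) k)%:R : R))%:E)%E.
Proof.
move=> symA arho Ymono n0; apply/andP; split.
  rewrite -size_reversed_paths -[X in size X](undup_id (uniq_reversed_paths _ _ _)).
  rewrite -counting_seq; apply: le_counting => u /=.
  rewrite mem_reversed_paths => /andP[/eqP un up]; split; last by rewrite un.
  by apply/words_beforeP => //; rewrite -size_eq0 un -lt0n.
pose s := flatten [seq reversed_paths A (rho 0%N) k | k <- iota 0 n.+1].
apply: (@le_trans _ _ (counting [set` s])).
  apply: le_counting => u /= [/(words_beforeP _ symA arho)[_ up]].
  rewrite Ymono => un; apply/flattenP; exists (reversed_paths A (rho 0%N) (size u)).
    by apply: map_f; rewrite mem_iota.
  by rewrite mem_reversed_paths eqxx.
rewrite counting_seq lee_fin -natr_sum ler_nat.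
apply: leq_trans (size_undup _) _.
rewrite size_flatten /shape -map_comp sumnE big_map -[n.+1]subn0 -/(index_iota 0 _).
by rewrite big_mkord leq_sum// => k _; rewrite /= size_reversed_paths.
Qed.

(** * Lower and upper limits at infinity *)

Lemma limf_esup_pinftyT (R : realType) (F : R -> \bar R) :
  (forall B M : R, exists2 T, M < T & (B%:E <= F T)%E) ->
  limf_esup F (pinfty_nbhs R) = +oo%E.
Proof.
move=> h; rewrite limf_esupE; apply/eqP; rewrite -leye_eq.
apply: le_ereal_inf_tmp => _ [V [M [_ MV]] <-].
rewrite leye_eq; apply/eqP/eq_infty => B.
have [T MT BT] := h B M; apply: le_ereal_sup_tmp; exists (F T) => //.
by exists T => //; apply: MV.
Qed.

Lemma limf_einf_pinfty0 (R : realType) (F : R -> \bar R) :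
  (forall T, 0 <= F T)%E ->
  (forall e M : R, 0 < e -> exists2 T, M < T & (F T <= e%:E)%E) ->
  limf_einf F (pinfty_nbhs R) = 0%E.
Proof.
move=> F0 h; rewrite limf_einfE; apply/eqP; rewrite eq_le; apply/andP; split.
  apply: ge_ereal_sup => _ [V [M [_ MV]] <-].
  apply/lee_addgt0Pr => e e0; rewrite add0e.
  have [T MT Te] := h e M e0; apply: le_trans Te; apply: ereal_inf_lbound.
  by exists T => //; apply: MV.
apply: le_ereal_sup_tmp; exists (ereal_inf (F @` setT)).
  by exists setT => //; apply: filterT.
by apply: le_ereal_inf_tmp => _ [T _ <-].
Qed.

(** * Bounds for the counting function and the exponent *)

Lemma random_ergodic_sum_const (R : realType) (E : Type) (alpha : E -> R)
    (a z w : R) n rho (lam : Lambda z w) :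
  (forall e : letter z w, 0 < ssval e) -> (forall e, alpha e = a) ->
  random_ergodic_sum alpha n rho lam =
  ln a *+ n + \sum_(i < n) ln (ssval (lam (Posz i))).
Proof.
move=> lam0 alphaE; rewrite /random_ergodic_sum (ergodic_sum_const _ _ alphaE).
congr (_ + _); have prod_gt0 m : 0 < \prod_(i < m) ssval (lam (Posz i)).
  by rewrite prodr_gt0.
rewrite gtr0_norm//; elim: n => [|n IH]; first by rewrite !big_ord0 ln1.
rewrite !big_ord_recr /= lnM ?posrE; first by congr (_ + _); exact: IH.
  exact: prod_gt0.
exact: lam0.
Qed.

Lemma sum_geometric_le (R : realFieldType) (r : R) n :
  1 < r -> \sum_(k < n.+1) r ^+ k <= r / (r - 1) * r ^+ n.
Proof.
move=> r1; have r10 : 0 < r - 1 by rewrite subr_gt0.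
rewrite mulrAC -exprS ler_pdivlMr// mulrC -subrX1.
by rewrite gerBl.
Qed.

(** All logarithms are negative, so the level grows with [n] and [counting_level] applies. As
    [r > 1], the sum over shorter words is geometric and comparable to its last term. *)
Lemma counting_function_bounds (R : realType) (E : finType) (A : rel E)
    (alpha : E -> R) (a z w r D : R) (rho : nat -> E) (lam : Lambda z w) n :
  symmetric A -> admissible A rho ->
  (forall e, alpha e = a) -> 0 < a < 1 -> (forall e : letter z w, 0 < ssval e < 1) ->
  1 < r -> 0 < D ->
  (forall e n, D^-1 * r ^+ n <= (path_count A e n)%:R <= D * r ^+ n) ->
  (0 < n)%N ->
  ((D^-1 * r ^+ n)%:E <=
   counting_function A alpha rho lam
     (- (ln a *+ n + \sum_(i < n) ln (ssval (lam (Posz i))))) <=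
   (D * (r / (r - 1)) * r ^+ n)%:E)%E.
Proof.
move=> symA arho alphaE /andP[a0 a1] lam01 r1 D0 HD n0.
pose Y n := - (ln a *+ n + \sum_(i < n) ln (ssval (lam (Posz i)))).
have Ymono : {mono Y : i j / (i <= j)%N >-> i <= j}.
  apply: Order.NatMonotonyTheory.incnP => i; rewrite /Y ltrN2 big_ord_recr/= mulrSr.
  rewrite addrACA gtrDl.
  have la : ln a < 0 by rewrite ln_lt0 ?a0.
  have ll : ln (ssval (lam (Posz i))) < 0 by apply: ln_lt0; exact: lam01.
  by rewrite -oppr_gt0 opprD addr_gt0 ?oppr_gt0.
rewrite -/(Y n) (_ : counting_function _ _ _ _ _ =
    counting [set u | words_before A rho u /\ (Y (size u) <= Y n)%R]); last first.
  rewrite /counting_function; congr counting; apply/funext => u /=.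
  have lam0 (e : letter z w) : 0 < ssval e by case/andP: (lam01 e).
  by rewrite (random_ergodic_sum_const _ _ _ lam0 alphaE) lerNl.
have /andP[lo hi] := counting_level symA arho Ymono n0.
apply/andP; split.
  by apply: le_trans lo; rewrite lee_fin; case/andP: (HD (rho 0%N) n).
apply: (le_trans hi); rewrite lee_fin -mulrA.
apply: le_trans (ler_wpM2l (ltW D0) (sum_geometric_le n r1)).
by rewrite mulr_sumr; apply: ler_sum => k _; case/andP: (HD (rho 0%N) k).
Qed.

(** A sequence bounded by [C n] stays below [C N] up to time [N], so it can exceed [max B (C N)]
    only later. *)
Lemma unbounded_far (R : realType) (X : nat -> R) (C B : R) (N : nat) :
  (forall n, X n <= C *+ n) -> 0 <= C -> (forall c : nat, exists n, c%:R < X n) ->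
  exists n, [/\ (N <= n)%N, (0 < n)%N & B < X n].
Proof.
move=> XC C0 Xunb.
have [n hn] := Xunb (Num.truncn (Num.max B (C *+ N))).+1.
have {hn} : Num.max B (C *+ N) < X n by apply: lt_trans (truncnS_gt _) hn.
rewrite gt_max => /andP[Bn Nn]; exists n.
have Cn := lt_le_trans Nn (XC n).
have Nltn : (N < n)%N.
  by rewrite ltnNge; apply/negP => nN; move: Cn; rewrite ltNge ler_wpMn2l.
by split => //; [exact: ltnW|exact: leq_trans Nltn].
Qed.

(** The expected pressure is affine and decreasing in [x], so the set in question is the half-line
    starting at its zero. *)
Lemma delta_LambdaE (R : realType) (E : finType) (A : rel E)
    (alpha : E -> R) (z w p q a r : R) :
  (forall x, pressure A (potential alpha) x = (ln r + x * ln a)%:E) ->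
  ln a + (p * ln z + q * ln w) < 0 ->
  delta_Lambda A alpha z w p q = ln r / - (ln a + (p * ln z + q * ln w)).
Proof.
move=> PE; set m := p * ln z + q * ln w => mu0; rewrite /delta_Lambda.
rewrite (_ : [set x | _] = `[ln r / - (ln a + m), +oo[%classic) ?inf_itv//.
apply/funext => x; rewrite /= in_itv/= andbT /expected_pressure PE -EFinD lee_fin.
rewrite ler_pdivrMr ?oppr_gt0//; congr is_true.
by rewrite -/m -addrA -mulrDr mulrN -[in RHS]subr_le0 opprK.
Qed.

Unset Implicit Arguments.

Theorem theorem4 (R : realType) (z w p q : R)
  (hz : 0 < z) (hzw : z < w) (hw : w < 1)
  (hp : 0 < p) (hq : 0 < q) (hpq : p + q = 1)
  (nu : probability (Lambda z w) R) (hnu : is_bernoulli p q nu)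
  (A : rel 'I_2) (hA : irreducible_incidence A)
  (alpha beta : 'I_2 -> R)
  (halpha : forall e, 0 < alpha e < 1) (hbeta : forall e, 0 < beta e < 1)
  (hphi : forall e, phi alpha beta e @` `[0, 1] `<=` `[0, 1])
  (hdisj : (phi alpha beta ord0 @` `]0, 1[) `&`
           (phi alpha beta ord_max @` `]0, 1[) = set0)
  (a : R) (halpha0 : alpha ord0 = a) (halpha1 : alpha ord_max = a)
  (hreg : strongly_regular A (potential alpha)) :
  forall rho : nat -> 'I_2, admissible A rho ->
  {ae nu, forall lam : Lambda z w,
    let F (T : R) : \bar R :=
      (counting_function A alpha rho lam T *
       ((expR (delta_Lambda A alpha z w p q * T))^-1)%:E)%E in
    limf_einf F (pinfty_nbhs R) = 0%E /\
    limf_esup F (pinfty_nbhs R) = +oo%E}.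
Proof.
move=> rho arho.
have w0 : 0 < w := lt_trans hz hzw.
have zw : z != w by rewrite lt_eqF.
have alphaE e : alpha e = a by have [->|->] := ord2P e.
have /andP[a0 a1] : 0 < a < 1 by rewrite -halpha0.
have lnw : ln w < 0 by rewrite ln_lt0 ?w0.
have lnz : ln z < 0 by rewrite ln_lt0 ?hz ?(lt_trans hzw).
have lna : ln a < 0 by rewrite ln_lt0 ?a0.
have symA := irreducible_sym hA.
have [r [v [r0 v0 vE]]] := irreducible_perron R hA.
have PE x := pressure_const x ord0 alphaE r0 v0 vE.
(* The pressure vanishes at some [x > 0], hence [ln r = - x ln a], which is positive. *)
have lnr : 0 < ln r.
  case: (hreg) => [[x x0 +] _]; rewrite PE => -[] /eqP.
  by rewrite addr_eq0 => /eqP ->; rewrite oppr_gt0 pmulr_rlt0.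
have r1 : 1 < r by rewrite -ltr_ln ?posrE// ln1.
have [D D0 HD] := path_count_growth r0 v0 vE.
pose m := p * ln z + q * ln w.
pose mu := - (ln a + m).
have m0 : m < 0 by rewrite -oppr_gt0 opprD -!mulrN addr_gt0// mulr_gt0 ?oppr_gt0.
have mu0 : 0 < mu by rewrite oppr_gt0 -oppr_gt0 opprD addr_gt0 ?oppr_gt0.
pose delta := ln r / mu.
have delta0 : 0 < delta by rewrite divr_gt0.
have -> : delta_Lambda A alpha z w p q = delta.
  by rewrite (delta_LambdaE PE)// -oppr_gt0.
have lam01 (e : letter z w) : 0 < ssval e < 1.
  have [->|->] := letterP e; rewrite /= ?w0 ?hw ?hz//.
  exact: lt_trans hzw hw.
pose d (e : letter z w) := ln (ssval e) - m.
have dz : d (letter_z z w) = q * (ln z - ln w).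
  rewrite /d /m /= -[X in X - _]mul1r -hpq; ring.
have dw : d (letter_w z w) = p * (ln w - ln z).
  rewrite /d /m /= -[X in X - _]mul1r -hpq; ring.
have dz0 : d (letter_z z w) != 0.
  by rewrite dz mulf_neq0 ?(gt_eqF hq)// subr_eq0 lt_eqF// ltr_ln ?posrE.
have mean0 : p * d (letter_z z w) + q * d (letter_w z w) = 0.
  by rewrite dz dw; ring.
(* The negated steps are centered too; they give unboundedness from below. *)
pose d' (e : letter z w) := - d e.
have up := walk_unbounded zw hp hq hpq hnu mean0 dz0.
have down : {ae nu, forall lam, forall c : nat, exists n, c%:R < walk d' 0 n lam}.
  apply: (walk_unbounded zw hp hq hpq hnu); last by rewrite oppr_eq0.
  by rewrite !mulrN -opprD mean0 oppr0.
move: up down; apply: filterS2 => lam up down.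
set F := (F in limf_einf F _).
have walkN n : walk d' 0 n lam = - walk d 0 n lam by rewrite /walk sumrN.
pose C := `|d (letter_z z w)| + `|d (letter_w z w)|.
have C0 : 0 <= C by rewrite addr_ge0.
have walk_bound n : `|walk d 0 n lam| <= C *+ n.
  rewrite (le_trans (ler_norm_sum _ _ _))//.
  rewrite -[n in leRHS](card_ord n) -sumr_const; apply: ler_sum => i _.
  have [->|->] := letterP (lam (Posz (0 + i))); rewrite /C ?lerDl ?lerDr//.
pose Y n := - (ln a *+ n + \sum_(i < n) ln (ssval (lam (Posz i)))).
have YE n : Y n = mu *+ n - walk d 0 n lam.
  rewrite /Y /walk /d sumrB sumr_const card_ord /mu.
  rewrite mulNrn mulrnDl opprB; ring.
(* Linear growth of the levels, which makes [T = Y n] exceed any given [M]. *)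
have Y_ge n : - ln a *+ n <= Y n.
  rewrite /Y opprD -mulNrn lerDl oppr_ge0; apply: sumr_le0 => i _.
  by apply: ltW; apply: ln_lt0; exact: lam01.
(* Since [delta * mu = ln r], the factor [exp (- delta Y_n)] cancels [r ^ n] and leaves the
   exponential of the walk. *)
have FY n : (0 < n)%N ->
    ((D^-1 * expR (delta * walk d 0 n lam))%:E <= F (Y n) <=
     (D * (r / (r - 1)) * expR (delta * walk d 0 n lam))%:E)%E.
  move=> n0.
  have a01 : 0 < a < 1 by rewrite a0.
  have /andP[lo hi] := counting_function_bounds lam symA arho alphaE a01 lam01 r1 D0 HD n0.
  have scale : (expR (delta * Y n))^-1 = (r ^+ n)^-1 * expR (delta * walk d 0 n lam).
    rewrite -[r in r ^+ n]lnK ?posrE// -expRM_natl -!expRN -expRD YE -[mu *+ n]mulr_natl /delta.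
    have mun0 : mu != 0 by rewrite gt_eqF.
    by congr expR; clearbody mu; field.
  have rn : 0 < r ^+ n by rewrite exprn_gt0.
  have e0 : 0 <= (expR (delta * Y n))^-1 by rewrite invr_ge0 expR_ge0.
  have cancel c : c * expR (delta * walk d 0 n lam) =
      c * r ^+ n * (expR (delta * Y n))^-1.
    by rewrite scale mulrA -[c * _ * _]mulrA mulfV ?gt_eqF// mulr1.
  rewrite !cancel !EFinM /F; apply/andP; split; apply: lee_wpmul2r => //;
    by rewrite -EFinM.
have far (B M : R) (X : nat -> R) : (forall n, X n <= C *+ n) ->
    (forall c : nat, exists n, c%:R < X n) ->
    exists n, [/\ (0 < n)%N, M < Y n & B < X n].
  move=> XC Xunb.
  have [n [Nn n0 Bn]] := unbounded_far B (Num.truncn (M / - ln a)).+1 XC C0 Xunb.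
  exists n; split=> //; apply: lt_le_trans (Y_ge n).
  rewrite -mulr_natr mulrC -ltr_pdivrMr ?oppr_gt0//.
  by apply: lt_le_trans (truncnS_gt _) _; rewrite ler_nat.
split.
- apply: limf_einf_pinfty0 => [T|e M e0].
    rewrite /F mule_ge0// ?lee_fin ?invr_ge0 ?expR_ge0//.
    by rewrite /counting_function /counting; case: ifP.
  pose K := D * (r / (r - 1)).
  have K0 : 0 < K by rewrite mulr_gt0// divr_gt0// subr_gt0.
  (* Beyond this threshold for the negated walk, [K exp (delta W_n)] is at most [e]. *)
  have [|n [n0 MY Bn]] := far (- ln (e / K) / delta) M _ _ down.
    by move=> n; rewrite walkN (le_trans (ler_norm _))// normrN.
  exists (Y n) => //; have /andP[_ hi] := FY n n0.
  apply: le_trans hi _; rewrite lee_fin mulrC -ler_pdivlMr//.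
  rewrite -[leRHS]lnK ?posrE ?divr_gt0// ler_expR mulrC.
  move: Bn; rewrite walkN ltr_pdivrMr// mulNr ltrN2; exact: ltW.
- apply: limf_esup_pinftyT => B M.
  (* Here [delta W_n >= B D], and [exp x >= 1 + x] brings the lower bound for [F] above [B]. *)
  have [|n [n0 MY Bn]] := far (B * D / delta) M _ _ up.
    by move=> n; rewrite (le_trans (ler_norm _)).
  exists (Y n) => //; have /andP[lo _] := FY n n0.
  apply: le_trans lo; rewrite lee_fin mulrC ler_pdivlMr//.
  move: Bn; rewrite ltr_pdivrMr// [ltRHS]mulrC => /ltW Bn.
  by rewrite (le_trans Bn)// (le_trans _ (expR_ge1Dx _))// lerDr.
Qed.
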